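(* Let $A\vec x=0$ be a partition-regular system of finitely many linear equations with $n$ variables. Then, for any additively normal set $S\subset\mathbb N$ one can find a solution $\vec x=(x_1,x_2,\dots,x_n)$ with all entries in $S$.
   Context: $\mathbb N=\{1,2,\dots\}$. Here $A$ is a matrix with integer coefficients. The system is partition-regular if for any finite coloring of $\mathbb N$ there exists a monochromatic solution (a solution with all entries in $\mathbb N$ and of the same color). A set $S\subset\mathbb N$ is additively normal if it is $(F_n)$-normal for some F{\o}lner sequence $(F_n)$ in $(\mathbb N,+)$, i.e., a sequence of (nonempty) finite subsets of $\mathbb N$ with $\lim_n|F_n\cap(F_n-k)|/|F_n|=1$ for every $k\in\mathbb N$. $S$ is $(F_n)$-normal if for $x=\mathbf 1_S$, every nonempty finite $K\subset\mathbb N$ and every $B\in\{0,1\}^K$, $\lim_n\frac1{|F_n|}|\{m\in\mathbb N\cup\{0\}:(\forall i\in K)\ i+m\in F_n\text{ and }x_{i+m}=B(i)\}|=2^{-|K|}$. *)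

(* Defs.v *)
From HB Require Import structures.
From mathcomp Require Import all_boot all_order all_algebra finmap.
From mathcomp Require Import boolp classical_sets functions cardinality reals.
From mathcomp Require Import topology normedtype sequences.

Set Implicit Arguments.
Unset Strict Implicit.
Unset Printing Implicit Defensive.

Import Order.TTheory GRing.Theory Num.Theory.
Import numFieldNormedType.Exports.

Local Open Scope classical_set_scope.
Local Open Scope fset_scope.
Local Open Scope ring_scope.

(* Natural numbers start at 1 in the definitions below: objects living in
   {1, 2, ...} are carried by [nat] together with a positivity condition. *)

Definition is_solution (p n : nat) (A : 'M[int]_(p, n)) (x : 'I_n -> nat) :
    Prop :=
  A *m (\col_j (x j)%:Z) = 0.

(* The value of a colouring at 0 plays no role. *)
Definition partition_regular (p n : nat) (A : 'M[int]_(p, n)) : Prop :=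
  forall (r : nat) (c : nat -> 'I_r),
    exists (x : 'I_n -> nat) (a : 'I_r),
      [/\ is_solution A x,
          forall j, (0 < x j)%N
        & forall j, c (x j) = a].

Definition folner_sequence (R : realType) (F : nat -> {fset nat}) : Prop :=
  [/\ forall n, F n != fset0,
      forall n m, m \in F n -> (0 < m)%N
    & forall k, (0 < k)%N ->
        (#|` [fset m in F n | (m + k)%N \in F n]|%:R / #|` F n|%:R : R)
          @[n --> \oo] --> (1 : R)].

(* The starting point m ranges over all of [nat], 0 included. The set of
   occurrences is finite because K is nonempty and E is finite, so that
   [fset_set] does not take its default value. *)
Definition occurrences (S : set nat) (E K : {fset nat}) (B : {ffun K -> bool}) :
    set nat :=
  [set m | forall i : K,
     ((val i + m)%N \in E) /\ ((val i + m)%N \in S) = B i].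

Definition normal_along (R : realType) (F : nat -> {fset nat}) (S : set nat) :
    Prop :=
  forall (K : {fset nat}) (B : {ffun K -> bool}),
    K != fset0 -> (forall i, i \in K -> (0 < i)%N) ->
    (#|` fset_set (occurrences S (F n) B)|%:R / #|` F n|%:R : R)
      @[n --> \oo] --> (2 ^- #|` K| : R).

Definition additively_normal (R : realType) (S : set nat) : Prop :=
  exists F : nat -> {fset nat}, folner_sequence R F /\ normal_along R F S.

(* Main.v *)
Require Import Defs.
From HB Require Import structures.
From mathcomp Require Import all_boot all_order all_algebra finmap.
From mathcomp Require Import boolp classical_sets functions cardinality reals.
From mathcomp Require Import topology normedtype sequences.
From mathcomp Require Import zify ring.

Set Implicit Arguments.
Unset Strict Implicit.
Unset Printing Implicit Defensive.

Import Order.TTheory GRing.Theory Num.Theory.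
Import numFieldNormedType.Exports.
Local Open Scope ring_scope.

(** Write A_j for the columns of A. Solutions of A x = 0 cannot be translated,
    so the fact that a normal set contains every finite 0-1 pattern does not
    yield a solution at once. Rado's columns condition bridges this gap.

    From partition regularity: colour a positive integer by its last nonzero
    digit in base q, for a large prime q, and take a monochromatic solution x,
    of digit d. Let the level of j be the exponent of q in x_j. If u is an
    integer row vector with u A_j = 0 on all levels below t, reading
    u (A x) = 0 modulo q^(t+1) gives that q divides d times the sum of u A_j
    over level t, hence divides that sum ([digit_obstruction]). Only finitely
    many pairs of sets of indices can arise as (levels below t, level t). Fix
    in advance, for each pair, one u making this sum nonzero whenever there is
    such a u, and take q larger than the absolute values of all these sums: a
    positive multiple of q cannot be that small, so no such u exists. By linear
    algebra over the rationals ([integer_alternative]) there is then for each t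
    an integer kernel vector of A equal to a constant c > 0 on level t and to 0
    on higher levels ([partition_regular_columns]).

    From normality: S contains arbitrarily long intervals
    ([normal_along_thick]), because the pattern made of N ones has positive
    frequency. These intervals suffice: the levels are treated from the top
    one downwards, and at level t a multiple y c of c is added to the entries
    of level t, by adding y times the kernel vector for t. The entries of
    higher levels, already in S, do not change; a long interval of S receives
    all entries of level t for a suitable y ([thick_solution]). *)

(** * Thickness of normal sets *)

Definition thick (S : set nat) : Prop :=
  forall N : nat, exists m : nat, forall i, (0 < i <= N)%N -> S (i + m)%N.

(** If no translate of the block of N ones occurred in S, its frequency along F
    would be 0 rather than 2^-N. *)
Lemma normal_along_thick (R : realType) (F : nat -> {fset nat}) (S : set nat) :
  normal_along R F S -> thick S.
Proof.
move=> hN [|N]; first by exists 0%N => i; lia.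
pose K := [fset i | i in iota 1 N.+1]%fset.
pose B : {ffun K -> bool} := [ffun=> true].
have KE i : (i \in K) = (0 < i <= N.+1)%N.
  by rewrite /K !inE /= mem_iota; lia.
have K0 : K != fset0 by apply/fset0Pn; exists 1%N; rewrite KE.
have Kpos i : i \in K -> (0 < i)%N by rewrite KE => /andP[].
have cvgK := hN K B K0 Kpos.
apply: contrapT => nothick.
have occ0 k : occurrences S (F k) B = set0.
  apply/seteqP; split=> m //= hm; apply: nothick; exists m => i hi.
  have iK : i \in K by rewrite KE.
  by have [_] := hm [` iK]%fset; rewrite ffunE /= => /set_mem.
move: cvgK; under eq_fun do rewrite occ0 fset_set0 cardfs0 mul0r.
move=> /cvg_lim; rewrite lim_cst// => /(_ (@Rhausdorff R)) /esym/eqP.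
by rewrite invr_eq0 expf_eq0 pnatr_eq0 andbF.
Qed.

(** One multiple y c serves all w in a bounded range simultaneously: this is
    what lets the entries of a whole level enter S together. *)
Lemma thick_translates (S : set nat) (c : nat) (W : nat) :
  thick S -> (0 < c)%N ->
  exists y : int, forall w : int, (`|w| <= W)%N ->
    exists2 z : nat, S z & w + y * c%:Z = z%:Z.
Proof.
(* The middle of an interval of length 2 W + c, at distance W from both ends,
   has length c and thus contains a multiple of c. *)
move=> /(_ (W + W + c)%N)[m hm] c0.
exists ((m + W) %/ c).+1%:Z => w hw.
have e1 := divn_eq (m + W) c; have e2 := ltn_pmod (m + W) c0.
set d := ((m + W) %/ c)%N in e1 *; set r := ((m + W) %% c)%N in e1 e2.
exists (absz (w + d.+1%:Z * c%:Z)); last by nia.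
set z := absz _; have -> : z = (z - m + m)%N by nia.
by apply: hm; nia.
Qed.

(** * Kernel vectors with a constant block *)

Lemma clear_denominators (m n : nat) (B : 'M[rat]_(m, n)) :
  exists2 D : nat, (0 < D)%N &
    exists C : 'M[int]_(m, n), map_mx intr C = D%:R *: B.
Proof.
pose D := (\prod_(ij : 'I_m * 'I_n) `|denq (B ij.1 ij.2)|)%N.
exists D; first by rewrite prodn_gt0// => ij; rewrite absz_gt0 denq_neq0.
exists (\matrix_(i, j)
  (numq (B i j) * (D %/ `|denq (B i j)|)%:Z)).
apply/matrixP => i j; rewrite !mxE rmorphM /=.
have dvdD : (`|denq (B i j)| %| D)%N.
  by rewrite /D (bigD1 (i, j))//= dvdn_mulr.
rewrite -[in RHS](divq_num_den (B i j)) -[in RHS](divnK dvdD) natrM.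
have -> : (`|denq (B i j)|%N%:R : rat) = (denq (B i j))%:~R.
  by rewrite -[in RHS](gtz0_abs (denq_gt0 _)) -pmulrn.
by rewrite -pmulrn; field; rewrite intr_eq0 denq_neq0.
Qed.

(** For J disjoint from I, such a vector witnesses that the sum of the columns
    of A indexed by J is a rational combination of those indexed by I: this is
    one clause of Rado's columns condition. *)
Definition has_block_vector (p n : nat) (A : 'M[int]_(p, n))
    (I J : {set 'I_n}) : Prop :=
  exists (v : 'cV[int]_n) (c : nat),
    [/\ (0 < c)%N, A *m v = 0
      & forall j, j \notin I -> v j 0 = c%:Z *+ (j \in J)].

(** Either the sum of the columns in J lies in the rational span of the columns
    in I, or some linear functional vanishing on this span detects it. Clearing
    denominators makes both certificates integral. *)
Lemma integer_alternative (p n : nat) (A : 'M[int]_(p, n)) (I J : {set 'I_n}) :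
  has_block_vector A I J \/
  (exists u : 'rV[int]_p,
    (forall i, i \in I -> (u *m A) 0 i = 0) /\
    \sum_(j in J) (u *m A) 0 j != 0).
Proof.
pose M : 'M[rat]_(p, n) := map_mx intr A.
pose DI : 'M[rat]_n := diag_mx (\row_j (j \in I)%:R).
pose eJ : 'rV[rat]_n := \row_j (j \in J)%:R.
have inj : injective (intr : int -> rat) := @intr_inj _.
(* The rows of DI *m M^T are the transposed columns of A indexed by I, padded
   with zero rows, and eJ *m M^T is the transposed sum of those in J. *)
case: (boolP (eJ *m M^T <= DI *m M^T)%MS) => [/submxP[w hw]|].
  left.
  have [D D0 [v hv]] := clear_denominators (eJ - w *m DI)^T.
  exists v, D; split=> //.
    have MAv : map_mx intr (A *m v) = 0 :> 'cV[rat]_p.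
      rewrite map_mxM hv -/M -scalemxAr -[M]trmxK -trmx_mul mulmxBl hw mulmxA.
      by rewrite subrr trmx0 scaler0.
    apply/colP => i; apply: inj.
    by have := congr1 (fun X : 'cV[rat]_p => X i 0) MAv; rewrite !mxE.
  move=> j jI; apply: inj.
  have := congr1 (fun X : 'cV[rat]_n => X j 0) hv.
  rewrite /DI mul_mx_diag !mxE => ->; rewrite (negPf jI) mulr0 subr0.
  by case: (j \in J); rewrite /= ?mulr1 ?mulr0 // -pmulrn.
rewrite submxE => /eqP sN0; right.
set X := cokermx _ in sN0.
have DX : DI *m M^T *m X = 0 by exact: mulmx_coker.
have [k sk] : exists k, (eJ *m M^T *m X) 0 k != 0.
  apply: contrapT => h; apply: sN0; apply/rowP => k; rewrite [RHS]mxE.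
  by apply/eqP; apply: contrapT => /negP hk; apply: h; exists k.
have [D D0 [u hu]] := clear_denominators (col k X)^T.
have DN0 : (D%:R : rat) != 0 by rewrite pnatr_eq0 -lt0n.
have uA j : ((u *m A) 0 j)%:~R = D%:R * (M^T *m X) j k :> rat.
  have := congr1 (fun Y : 'rV[rat]_n => Y 0 j) (map_mxM intr u A).
  rewrite mxE => ->; rewrite hu -/M -scalemxAl mxE -[M in LHS]trmxK -trmx_mul.
  by rewrite mxE colE mulmxA -colE mxE.
exists u; split=> [i iI|].
  apply: inj; rewrite uA.
  have := congr1 (fun Y : 'M[rat]_(n, p) => Y i k) DX.
  rewrite -mulmxA mul_diag_mx; move: (M^T *m X) => Y; rewrite !mxE iI mul1r => ->.
  by rewrite mulr0.
apply: contraNneq sk => s0.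
have : D%:R * (eJ *m M^T *m X) 0 k == 0; last by rewrite mulf_eq0 (negPf DN0).
have <- : (\sum_(j in J) (u *m A) 0 j)%:~R = 0 :> rat by rewrite s0.
rewrite rmorph_sum /= -mulmxA [(eJ *m _) 0 k]mxE mulr_sumr [X in _ == X]big_mkcond /=.
apply/eqP; apply: eq_bigr => j _; rewrite uA [eJ 0 j]mxE.
by case: ifP; rewrite ?mul1r // mul0r mulr0.
Qed.

(** * Last nonzero digits *)

Definition last_digit (q x : nat) : nat := ((x %/ q ^ logn q x) %% q)%N.

Lemma last_digitP (q x : nat) : prime q -> (0 < x)%N ->
  ~~ (q %| last_digit q x)%N /\
  exists e, x = (q ^ logn q x * (e * q + last_digit q x))%N.
Proof.
move=> qp x0; have q0 := prime_gt0 qp.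
have [l ql xE] := pfactor_coprime qp x0.
have dE : (x %/ q ^ logn q x)%N = l.
  by rewrite [X in (X %/ _)%N]xE mulnK ?expn_gt0 ?q0.
rewrite /last_digit dE; split.
  by rewrite /dvdn modn_mod -/(dvdn q l) -prime_coprime.
by exists (l %/ q)%N; rewrite -divn_eq mulnC.
Qed.

(** If every x_j ends in the digit d followed by l_j zeros in base q and a
    vanishes below level t, then the sum of the a_j x_j is congruent modulo
    q^(t+1) to q^t d times the sum of the a_j over level t. *)
Lemma digit_obstruction (n q d t : nat) (x l : 'I_n -> nat) (a : 'I_n -> int) :
  prime q -> ~~ (q %| d)%N ->
  (forall j, exists e, x j = (q ^ l j * (e * q + d))%N) ->
  (forall j, (l j < t)%N -> a j = 0) ->
  \sum_j a j * (x j)%:Z = 0 ->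
  (q %| absz (\sum_(j | l j == t) a j)%R)%N.
Proof.
move=> qp qd xE a0 ax0.
have /choice[k kE] : forall j, exists k : int,
    a j * (x j)%:Z = q%:Z ^+ t * ((if l j == t then a j else 0) * d%:Z + q%:Z * k).
  move=> j; have [e ->] := xE j.
  case: (ltngtP (l j) t) => [lt|gt|->].
  - by exists 0; rewrite a0 // mulr0 addr0 !mul0r mulr0.
  - exists (a j * q%:Z ^+ (l j - t.+1) * (e%:Z * q%:Z + d%:Z)).
    have -> : (q ^ l j = q ^ t * (q * q ^ (l j - t.+1)))%N.
      by rewrite -expnS -expnD; congr (_ ^ _)%N; lia.
    by rewrite !PoszM PoszD PoszM -!rmorphXn /=; ring.
  - by exists (a j * e%:Z); rewrite !PoszM PoszD PoszM -rmorphXn /=; ring.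
move: ax0; under eq_bigr do rewrite kE.
have qt0 : q%:Z ^+ t != 0 by rewrite expf_neq0 // eqz_nat -lt0n prime_gt0.
rewrite -mulr_sumr => /eqP; rewrite mulf_eq0 (negPf qt0) /= big_split /=.
rewrite -mulr_suml -mulr_sumr -big_mkcond /= => /eqP sum0.
have : (q %| absz ((\sum_(j | l j == t) a j) * d%:Z)%R)%N.
  rewrite -[q]/(`|q%:Z|%N) -dvdzE; apply/dvdzP; exists (- \sum_j k j).
  by apply/eqP; rewrite mulNr [X in - X]mulrC -addr_eq0 sum0.
by rewrite abszM Euclid_dvdM //= (negPf qd) orbF.
Qed.

(** * From partition regularity to the columns condition *)

(** Rado's columns condition for the ordered partition of the columns into the
    fibres of lev. *)
Definition columns_condition (p n : nat) (A : 'M[int]_(p, n))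
    (lev : 'I_n -> nat) : Prop :=
  forall t, has_block_vector A [set j | lev j < t]%N [set j | lev j == t].

(** This is the necessity half of Rado's theorem. The levels are the q-adic
    valuations of the entries of a solution that is monochromatic for the last
    nonzero digit in base q. *)
Lemma partition_regular_columns (p n : nat) (A : 'M[int]_(p, n)) :
  partition_regular A -> exists lev, columns_condition A lev.
Proof.
move=> hA.
(* The levels depend on q, so q has to beat the obstructions attached to all
   pairs of index sets. *)
have /choice[b hb] : forall IJ : {set 'I_n} * {set 'I_n}, exists b : nat,
    has_block_vector A IJ.1 IJ.2 \/ exists u : 'rV[int]_p,
      (forall i, i \in IJ.1 -> (u *m A) 0 i = 0) /\
      (0 < absz (\sum_(j in IJ.2) (u *m A) 0 j)%R <= b)%N.
  move=> [I J]; have [gd|[u [u0 us]]] := integer_alternative A I J.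
    by exists 0%N; left.
  exists (absz (\sum_(j in J) (u *m A) 0 j)); right; exists u.
  by rewrite absz_gt0 us /=.
have [q qb qp] := prime_above (\max_IJ b IJ)%N.
have [x [d [xsol x0 xd]]] :=
  hA q (fun m => Ordinal (ltn_pmod (m %/ q ^ logn q m) (prime_gt0 qp))).
have {}xd j : last_digit q (x j) = d by rewrite -(xd j).
exists (fun j => logn q (x j)) => t.
pose I := [set j | (logn q (x j) < t)%N].
pose J := [set j | logn q (x j) == t].
have [//|[u [u0 /andP[us ub]]]] := hb (I, J); exfalso.
have [j0 _] : exists j, j \in J.
  by apply/set0Pn; apply: contraTneq us => /= ->; rewrite big_set0.
have qd : ~~ (q %| d)%N by have [] := last_digitP qp (x0 j0); rewrite xd.
have : (q %| absz (\sum_(j | logn q (x j) == t) (u *m A) ord0 j)%R)%N.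
  apply: (@digit_obstruction n q d t x) => //.
  - by move=> j; have [_] := last_digitP qp (x0 j); rewrite xd.
  - by move=> j jt; apply: u0; rewrite inE.
  - have := congr1 (fun Y : 'cV[int]_p => (u *m Y) 0 0) xsol.
    rewrite mulmx0 mulmxA !mxE => h; rewrite -[RHS]h.
    by apply: eq_bigr => j _; rewrite [(\col_i _) j 0]mxE.
have sJ : \sum_(j in J) (u *m A) ord0 j =
          \sum_(j | logn q (x j) == t) (u *m A) ord0 j.
  by apply: eq_bigl => j; rewrite inE.
rewrite -sJ => /(dvdn_leq us) qs.
have := leq_trans qs (leq_trans ub (leq_bigmax (I, J))).
by rewrite leqNgt qb.
Qed.

(** * From the columns condition to solutions *)

(** The kernel vector for level t leaves the higher levels unchanged and
    translates all of level t by one multiple of c, whereas its effect on lower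
    levels is harmless since these are treated afterwards. *)
Lemma thick_solution (p n : nat) (A : 'M[int]_(p, n)) (lev : 'I_n -> nat)
    (S : set nat) :
  thick S -> columns_condition A lev ->
  exists x : 'I_n -> nat, is_solution A x /\ (forall j : 'I_n, S (x j)).
Proof.
move=> Sthick hlev.
pose L := (\max_j lev j).+1.
have step k : exists2 x : 'cV[int]_n, A *m x = 0 &
    forall j, (L - k <= lev j)%N -> exists2 z : nat, S z & x j 0 = z%:Z.
  elim: k => [|k [x Ax xS]].
    exists 0 => [|j]; first by rewrite mulmx0.
    by rewrite subn0 ltnNge leq_bigmax.
  have [v [c [c0 Av vE]]] := hlev (L - k.+1)%N.
  have [y yS] := thick_translates (\max_j absz (x j ord0)) Sthick c0.
  exists (x + y *: v) => [|j tj].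
    by rewrite mulmxDr Ax add0r -scalemxAr Av scaler0.
  rewrite !mxE vE ?inE -?leqNgt //; case: eqP => [_|ne].
    by rewrite mulr1n; apply: yS; exact: (leq_bigmax j).
  by rewrite mulr0 addr0; apply: xS; lia.
have [x Ax] := step L; rewrite subnn => xS.
exists (fun j => absz (x j 0)).
have xN j : S (absz (x j 0)) /\ (absz (x j 0))%:Z = x j 0.
  by have [//|z Sz ->] := xS j.
split=> [|j]; last by case: (xN j).
rewrite /is_solution -[RHS]Ax; congr (_ *m _).
by apply/colP => j; rewrite mxE; case: (xN j).
Qed.

Theorem theorem7p6 (R : realType) (p n : nat) (A : 'M[int]_(p, n))
    (hA : partition_regular A) (S : set nat)
    (hSpos : forall m : nat, S m -> (0 < m)%N)
    (hS : additively_normal R S) :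
  exists x : 'I_n -> nat, is_solution A x /\ (forall j : 'I_n, S (x j)).
Proof.
have [F [_ hF]] := hS.
have [lev hlev] := partition_regular_columns hA.
exact: thick_solution (normal_along_thick hF) hlev.
Qed.
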